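(* Let $p \in [1, +\infty)$, $A \in \mathcal M_d(\mathbb R)$, and let $\tau$ be a delay function such that, with $\sigma_1(t) = t - \tau(t)$ for $t \in \mathbb R_+$: - $\inf_{s \in [0, t]} \tau(s) > 0$ for every $t \geq 0$; - $\lim_{t \to +\infty} \sigma_1(t) = +\infty$; - $\tau$ is $(\mathfrak L, \mathfrak L)$-measurable, $\mathcal L(\sigma_1^{-1}(N)) = 0$ for every $N \in \mathfrak L$ with $\mathcal L(N) = 0$, the measure ${\sigma_1}_{\#} \mathcal L$ is $\sigma$-finite, and the Radon--Nikodym derivative $\varphi$ of ${\sigma_1}_{\#}\mathcal L$ with respect to $\mathcal L$ is bounded and satisfies $\lVert\varphi\rVert_{L^\infty(\mathbb R, \mathbb R)}\, \rho(A)^p < 1$. Let $h$ be the largest delay function associated with $\tau$, and let $x \in L^p_{\mathrm{loc}}(\lvert -h(0), +\infty), \mathbb R^d)$ be an $L^p$ solution of $$x(t) = A x(t - \tau(t)), \qquad t \geq 0,$$ with initial condition $x_0 \in L^p(\lvert -h(0), 0), \mathbb R^d)$. Then $x \in L^p(\lvert -h(0), +\infty), \mathbb R^d)$ and $\lVert x_t\rVert_{L^p(\lvert -h(t), 0), \mathbb R^d)} \to 0$ as $t \to +\infty$.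
   Context: $\mathbb R_+ = [0, +\infty)$, $\mathbb R_+^\ast = (0, +\infty)$; $\mathcal M_d(\mathbb R)$ is the set of real $d \times d$ matrices, $d$ a positive integer, and $\rho(A)$ is the spectral radius of $A$; $\mathfrak L$, $\mathfrak B$ are the Lebesgue and Borel $\sigma$-algebras and $\mathcal L$ is Lebesgue measure. A map $f\colon X \to Y$ is $(\mathfrak S_X, \mathfrak S_Y)$-measurable if $f^{-1}(B) \in \mathfrak S_X$ for all $B \in \mathfrak S_Y$; ${\sigma_1}_{\#}\mathcal L$ is the push-forward by $\sigma_1\colon \mathbb R_+ \to \mathbb R$ of Lebesgue measure on $\mathbb R_+$, a measure on $(\mathbb R, \mathfrak L)$. For $a \leq b$ in $\mathbb R \cup \{\pm\infty\}$, $\lvert a, b)$ denotes $[a, b)$ if $a > -\infty$ and $(a, b)$ if $a = -\infty$. A \emph{delay function} is any function $\tau\colon \mathbb R_+ \to \mathbb R_+^\ast$. Its \emph{largest delay function} is $h\colon \mathbb R_+ \to \mathbb R_+^\ast \cup \{+\infty\}$, $h(t) = t - \inf_{s \in [t, +\infty)} (s - \tau(s))$. An \emph{a.e. solution} is a function $x\colon \lvert -h(0), +\infty) \to \mathbb R^d$ such that, for every $\widetilde x\colon \lvert -h(0), +\infty) \to \mathbb R^d$ equal to $x$ a.e., we have $\widetilde x(t) = A \widetilde x(t - \tau(t))$ for a.e. $t \in \mathbb R_+$. An \emph{$L^p$ solution} is an $(\mathfrak L, \mathfrak B)$-measurable a.e. solution $x$ with $x \in L^p_{\mathrm{loc}}(\lvert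 -h(0), +\infty), \mathbb R^d)$. Its \emph{initial condition} is its restriction to $\lvert -h(0), 0)$. For $t \in \mathbb R_+$, $x_t\colon \lvert -h(t), 0) \to \mathbb R^d$ is defined by $x_t(s) = x(t + s)$. *)

(* Defs.v *)
From HB Require Import structures.
From mathcomp Require Export all_boot all_order all_algebra.
From mathcomp Require Export complex.
From mathcomp Require Export all_classical all_reals all_analysis.

Set Implicit Arguments.
Unset Strict Implicit.
Unset Printing Implicit Defensive.

Import Order.TTheory GRing.Theory Num.Theory.
Import numFieldNormedType.Exports.

Local Open Scope classical_set_scope.
Local Open Scope ring_scope.

(* A function defined on a subset D of the real line is represented by a total
   function on R; every notion below only looks at its values on D. *)

Section LebesgueSigmaAlgebra.
Context {R : realType}.

(* The real line equipped with the Lebesgue sigma-algebra, that is, the sets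
   that are Caratheodory-measurable for the Lebesgue outer measure. *)
Definition lebesgueType : measurableType _ :=
  caratheodory_type ((wlength (@idfun R))^*)%mu.

Definition leb : {measure set lebesgueType -> \bar R} :=
  @completed_lebesgue_measure R.

Lemma measurable_Rplus : measurable (`[0, +oo[ : set lebesgueType).
Proof.
apply: sub_caratheodory.
by have := @measurable_itv R `[0, +oo[%R.
Qed.

(* |a, b) is [a, b) if a > -oo, and ]a, b[ if a = -oo. *)
Definition lco (a b : \bar R) : set R := [set s | (a <= s%:E < b)%E].

(* Radon-Nikodym derivative of nu with respect to the Lebesgue measure; the
   library's 'd nu '/d mu is restricted to finite charges nu. *)
Definition is_RN_derivative (nu : set lebesgueType -> \bar R)
    (phi : lebesgueType -> R) : Prop :=
  [/\ measurable_fun setT phi, forall s, 0 <= phi s &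
      forall B : set lebesgueType, measurable B ->
        nu B = (\int[leb]_(s in B) (phi s)%:E)%E].

End LebesgueSigmaAlgebra.
Arguments lebesgueType : clear implicits.

Section VectorValuedLp.
Context {R : realType} {d : nat}.

Definition is_norm (N : 'cV[R]_d -> R) : Prop :=
  [/\ forall u v, N (u + v) <= N u + N v,
      forall a v, N (a *: v) = `|a| * N v &
      forall v, N v = 0 -> v = 0].

(* (Lebesgue, Borel)-measurability on D. *)
Definition borel_measurable_on (D : set R) (f : R -> 'cV[R]_d) : Prop :=
  forall B : set 'cV[R]_d, <<s [set U : set 'cV[R]_d | open U] >> B ->
    measurable (D `&` f @^-1` B : set (lebesgueType R)).

Definition Lp_norm (N : 'cV[R]_d -> R) (p : R) (D : set R)
    (f : R -> 'cV[R]_d) : \bar R :=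
  'N[leb]_(p%:E)[(fun s => (N (f s))%:E) \_ D]%E.

Definition in_Lp N p D f : Prop :=
  borel_measurable_on D f /\ (Lp_norm N p D f < +oo)%E.

Definition in_Lp_loc N p D f : Prop :=
  borel_measurable_on D f /\
  forall K : set R, compact K -> K `<=` D -> (Lp_norm N p K f < +oo)%E.

End VectorValuedLp.

Section SpectralRadius.
Context {R : realType} {d : nat}.

(* Maximal modulus of the complex eigenvalues. *)
Definition spectral_radius (A : 'M[R]_d) : R :=
  sup [set r | exists2 z : R[i],
    eigenvalue (map_mx (real_complex R) A) z & r = complex.Re `|z|].

End SpectralRadius.

Section DelayEquation.
Context {R : realType}.
Implicit Types tau : R -> R.

Definition delay_function tau : Prop := forall t, 0 <= t -> 0 < tau t.

Definition sigma1 tau (t : R) : R := t - tau t.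

Definition largest_delay tau (t : R) : \bar R :=
  (t%:E - ereal_inf [set (s - tau s)%:E | s in `[t, +oo[%classic])%E.

(* Push-forward by sigma1 of the Lebesgue measure on [0, +oo[. *)
Definition sigma1_pushforward tau : set (lebesgueType R) -> \bar R :=
  pushforward (mrestr leb measurable_Rplus)
    (sigma1 tau : lebesgueType R -> lebesgueType R).

Context {d : nat}.
Implicit Types x : R -> 'cV[R]_d.

Definition solution_domain tau : set R := lco (- largest_delay tau 0) +oo.

Definition ae_solution (A : 'M[R]_d) tau x : Prop :=
  forall y : R -> 'cV[R]_d,
    {ae leb, forall t : R, solution_domain tau t -> y t = x t} ->
    {ae leb, forall t : R, 0 <= t -> y t = A *m y (t - tau t)}.

Definition Lp_solution N p (A : 'M[R]_d) tau x : Prop :=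
  [/\ borel_measurable_on (solution_domain tau) x, ae_solution A tau x &
      in_Lp_loc N p (solution_domain tau) x].

(* x_t, a function on |- h(t), 0). *)
Definition history x (t : R) : R -> 'cV[R]_d := fun s => x (t + s).

End DelayEquation.

(* Main.v *)
(* Since rho(A) < r for some r with ||phi||_oo r^p < 1, there is a norm M on R^d
   with M(Av) <= r M(v). For T >= 0 and 0 <= t <= T the point sigma_1(t) lies in
   the domain of x and below T, so that, with I_T the integral of M(x)^p over
   [0, T] and J its integral over |-h(0), 0), the change of variables
   s = sigma_1(t) gives
     I_T <= r^p \int_0^T M(x(sigma_1(t)))^p dt <= ||phi||_oo r^p (J + I_T).
   As I_T is finite, I_T is bounded by a constant independent of T, hence x is
   in L^p. Finally, by translation invariance the norm of x_t is that of x on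
   |t - h(t), t), and t - h(t) tends to +oo because sigma_1 does. *)

Require Import Defs.
From mathcomp Require Import spectral mxpoly measurable_realfun ess_sup_inf.

Set Implicit Arguments.
Unset Strict Implicit.
Unset Printing Implicit Defensive.

Import Order.TTheory GRing.Theory Num.Theory.
Import numFieldNormedType.Exports.

Local Open Scope classical_set_scope.
Local Open Scope ring_scope.

(** * Complex moduli, the spectral radius and an adapted norm *)

Definition cmod (R : rcfType) (z : R[i]) : R := complex.Re `|z|.

Lemma cmodE (R : rcfType) (z : R[i]) : `|z| = (cmod z)%:C%C.
Proof. by rewrite RRe_real// ger0_real. Qed.

Lemma cmod_ge0 (R : rcfType) (z : R[i]) : 0 <= cmod z.
Proof. by rewrite -ler0c -cmodE. Qed.

Lemma cmod0 (R : rcfType) : cmod (0 : R[i]) = 0.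
Proof. by rewrite /cmod normr0. Qed.

Lemma cmodM (R : rcfType) (z w : R[i]) : cmod (z * w) = cmod z * cmod w.
Proof.
by apply: (@complexI R); rewrite -cmodE normrM !cmodE rmorphM.
Qed.

Lemma ler_cmodD (R : rcfType) (z w : R[i]) : cmod (z + w) <= cmod z + cmod w.
Proof.
by rewrite -lecR -cmodE rmorphD /= -!cmodE ler_normD.
Qed.

Lemma ler_cmod_sum (R : rcfType) (I : Type) (r : seq I) (P : pred I)
    (F : I -> R[i]) :
  cmod (\sum_(i <- r | P i) F i) <= \sum_(i <- r | P i) cmod (F i).
Proof.
elim/big_ind2 : _ => // [|z a w b za wb]; first by rewrite cmod0.
by rewrite (le_trans (ler_cmodD _ _))// lerD.
Qed.

Lemma cmod_real (R : rcfType) (a : R) : cmod (a%:C)%C = `|a|.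
Proof.
apply: (@complexI R).
by rewrite -cmodE normc_def /= expr0n addr0 sqrtr_sqr.
Qed.

Lemma cmod_eq0 (R : rcfType) (z : R[i]) : cmod z = 0 -> z = 0.
Proof. by move=> z0; apply/normr0_eq0; rewrite cmodE z0. Qed.

(** A [sup] bounds its set only if that set is bounded above. The eigenvalues are the roots of the
    characteristic polynomial, so the sum of the moduli of all roots is an upper bound. *)
Lemma le_spectral_radius (R : realType) (d : nat) (A : 'M[R]_d) (z : R[i]) :
  eigenvalue (map_mx (real_complex R) A) z -> cmod z <= spectral_radius A.
Proof.
set A' := map_mx _ A => Az; apply: ub_le_sup; last by exists z.
have p0 : char_poly A' != 0 by rewrite monic_neq0 ?char_poly_monic.
have [s Es] := closed_field_poly_normal (char_poly A').
exists (\sum_(w <- s) cmod w) => _ [w Aw ->].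
have ws : w \in s.
  move: Aw; rewrite eigenvalue_root_char Es rootZ ?lead_coef_eq0//.
  by rewrite root_prod_XsubC.
by rewrite (big_rem w ws) /= lerDl sumr_ge0// => i _; rewrite cmod_ge0.
Qed.

(* Over C, A is similar to a lower triangular matrix T; in the basis rescaled by
   the powers of a small e, the off-diagonal entries of T are at most e |T_ij|. *)
Lemma adapted_norm (R : realType) (d : nat) (A : 'M[R]_d) (r : R) :
  (0 < d)%N -> spectral_radius A < r ->
  exists2 M : 'cV[R]_d -> R, is_norm M & forall v, M (A *m v) <= r * M v.
Proof.
move=> d0 rAr; pose A' := map_mx (real_complex R) A.
(* [P] is unitary and T = P A' P^-1 satisfies T_ij = 0 for i < j, so the diagonal of [T] consists of
   eigenvalues of A. *)
have [P /unitarymx_unit Pu trigP] := Schur A' d0.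
have {trigP} /is_trig_mxP trigP : is_trig_mx (conjmx P A') by [].
set T := conjmx P A' in trigP.
have TPA : T *m P = P *m A' by rewrite /T conjumx// mulmxKV.
have Tdiag i : cmod (T i i) <= spectral_radius A.
  apply: le_spectral_radius; apply: (@eigenvalue_conjmx _ _ _ P A').
  - by rewrite stablemx_unit.
  - by rewrite row_free_unit.
  - change (eigenvalue T (T i i)).
    rewrite eigenvalue_root_char char_poly_trig; last exact/is_trig_mxP.
    by rewrite rootE horner_prod (bigD1 i)//= hornerXsubC subrr mul0r.
pose m := \sum_i \sum_j cmod (T i j).
have m0 : 0 <= m by do 2!rewrite sumr_ge0// => ? _; exact: cmod_ge0.
(* Small enough that rho(A) + e m <= r; the [+ 1] avoids a zero denominator, and e <= 1 makes the
   powers of e nonincreasing. *)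
pose e := Num.min 1 ((r - spectral_radius A) / (m + 1)).
have e0 : 0 < e by rewrite lt_min ltr01 divr_gt0 ?subr_gt0// ltr_wpDl.
have e1 : e <= 1 by rewrite ge_min lexx.
have em : spectral_radius A + e * m <= r.
  rewrite -lerBrDl (@le_trans _ _ (e * (m + 1)))//.
    by rewrite ler_wpM2l ?(ltW e0)// lerDl.
  by rewrite -ler_pdivlMr ?ltr_wpDl// ge_min lexx orbT.
pose c (v : 'cV[R]_d) : 'cV[R[i]]_d := P *m map_mx (real_complex R) v.
pose M v := \sum_(i < d) e ^+ i * cmod (c v i 0).
exists M.
  split=> [u v|a v|v].
  - rewrite /M -big_split; apply: ler_sum => i _ /=; rewrite -mulrDr.
    rewrite ler_wpM2l ?exprn_ge0 ?(ltW e0)//.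
    by rewrite /c map_mxD mulmxDr mxE ler_cmodD.
  - rewrite /M mulr_sumr; apply: eq_bigr => i _.
    by rewrite /c map_mxZ /= -scalemxAr mxE cmodM cmod_real mulrCA.
  - move=> /eqP; rewrite psumr_eq0 => [/allP Mv|i _]; last first.
      by rewrite mulr_ge0 ?cmod_ge0// exprn_ge0// ltW.
    have cv0 : c v = 0.
      apply/matrixP => i j; rewrite ord1 [RHS]mxE; apply: cmod_eq0.
      have := Mv i; rewrite mem_index_enum => /(_ isT).
      by rewrite mulf_eq0 expf_eq0 gt_eqF// andbF => /eqP.
    have : map_mx (real_complex R) v = 0.
      by rewrite -(mulKmx Pu (map_mx _ v)) -/(c v) cv0 mulmx0.
    move/matrixP => v0; apply/matrixP => i j; apply: (@complexI R).
    by have := v0 i j; rewrite !mxE.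
move=> v; set u := c v.
have cA : c (A *m v) = T *m u by rewrite /c map_mxM mulmxA -TPA -mulmxA.
have Mu : M v = \sum_(i < d) e ^+ i * cmod (u i 0) by [].
rewrite /M cA.
(* In row i of T u, weighted by e^i, the diagonal term is kept, and a term with j < i gains a factor
   e because e^i <= e^(j+1). *)
apply: (@le_trans _ _ (\sum_(i < d) (e ^+ i * (cmod (T i i) * cmod (u i 0)) +
   \sum_(j < d) e * (cmod (T i j) * (e ^+ j * cmod (u j 0)))))).
  apply: ler_sum => i _; rewrite mxE.
  apply: (@le_trans _ _ (e ^+ i * \sum_j cmod (T i j) * cmod (u j 0))).
    rewrite ler_wpM2l ?exprn_ge0 ?(ltW e0)//.
    rewrite (le_trans (ler_cmod_sum _ _ _))// ler_sum// => j _.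
    by rewrite cmodM.
  rewrite (bigD1 i)//= mulrDr lerD2l mulr_sumr big_mkcond/=.
  apply: ler_sum => j _; case: ifPn => [ji|_]; last first.
    by rewrite !mulr_ge0 ?cmod_ge0 ?exprn_ge0 ?(ltW e0).
  have [ij|] := ltnP i j.
    by rewrite trigP// cmod0 !(mul0r, mulr0).
  rewrite leq_eqVlt val_eqE (negbTE ji)/= => lji.
  rewrite mulrCA [leRHS]mulrCA ler_wpM2l ?cmod_ge0// mulrA ler_wpM2r ?cmod_ge0//.
  rewrite -exprS.
  rewrite -(subnK lji) exprD ler_piMl ?exprn_ge0 ?(ltW e0)//.
  by rewrite exprn_ile1// ltW.
rewrite big_split/=.
have e_le (j : 'I_d) : e ^+ j * cmod (u j 0) <= M v.
  rewrite Mu (bigD1 j)//= lerDl sumr_ge0// => i _.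
  by rewrite mulr_ge0 ?cmod_ge0 ?exprn_ge0 ?(ltW e0).
(* The diagonal contributes at most rho(A) M v, all the other entries at most e m M v. *)
apply: (@le_trans _ _ (spectral_radius A * M v + e * m * M v)); last first.
  rewrite -mulrDl ler_wpM2r// Mu sumr_ge0// => i _.
  by rewrite mulr_ge0 ?cmod_ge0 ?exprn_ge0 ?(ltW e0).
apply: lerD.
  rewrite Mu mulr_sumr; apply: ler_sum => i _.
  rewrite mulrCA ler_wpM2r//.
  by rewrite mulr_ge0 ?cmod_ge0 ?exprn_ge0 ?(ltW e0).
move: (M v) e_le => b e_le; rewrite /m mulr_sumr mulr_suml.
apply: ler_sum => i _; rewrite mulr_sumr mulr_suml; apply: ler_sum => j _.
by rewrite -mulrA ler_wpM2l ?(ltW e0)// ler_wpM2l ?cmod_ge0.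
Qed.

(** * Equivalence of norms on R^d *)

Section norms.
Context {R : realType} {d : nat}.
Implicit Types N M : 'cV[R]_d -> R.

Lemma is_norm0 N : is_norm N -> N 0 = 0.
Proof. by move=> [_ NZ _]; rewrite -(scale0r 0) NZ normr0 mul0r. Qed.

(** Follows from 0 = N (v - v) <= N v + N (- v) = 2 N v. *)
Lemma is_norm_ge0 N v : is_norm N -> 0 <= N v.
Proof.
move=> NN; have := NN => -[ND NZ _].
have := ND v (- v); rewrite subrr (is_norm0 NN) -scaleN1r NZ normrN1 mul1r.
by rewrite -mulr2n pmulrn_lge0.
Qed.

Lemma is_norm_sum N (I : Type) (r : seq I) (F : I -> 'cV[R]_d) : is_norm N ->
  N (\sum_(i <- r) F i) <= \sum_(i <- r) N (F i).
Proof.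
move=> NN; have := NN => -[ND _ _].
elim/big_ind2 : _ => // [|u a v b ua vb]; first by rewrite is_norm0.
by rewrite (le_trans (ND _ _))// lerD.
Qed.

(** Expansion in the canonical basis: C is the sum of the norms of the basis vectors, and [|v|] is
    the max norm. *)
Lemma is_norm_le_mx_norm N : is_norm N ->
  exists2 C, 0 <= C & forall v, N v <= C * `|v|.
Proof.
move=> NN; have := NN => -[_ NZ _].
exists (\sum_i N (delta_mx i 0)).
  by rewrite sumr_ge0// => i _; exact: is_norm_ge0.
move=> v; rewrite {1}(matrix_sum_delta v).
under eq_bigr do rewrite big_ord1.
rewrite (le_trans (is_norm_sum _ _ NN))// mulr_suml ler_sum// => i _.
rewrite NZ mulrC ler_wpM2l ?is_norm_ge0//.
rewrite [leRHS]/Num.norm/= mx_normrE.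
by apply: (@le_bigmax _ _ _ _ (fun ij => `|v ij.1 ij.2|) (i, 0)).
Qed.

Lemma is_norm_dist N u v : is_norm N -> `|N u - N v| <= N (u - v).
Proof.
move=> [ND NZ _]; rewrite ler_norml lerBlDr lerNl opprB lerBlDr.
rewrite -{1}opprB -scaleN1r NZ normrN1 mul1r.
by have := ND (u - v) v; have := ND (v - u) u; rewrite !subrK => -> ->.
Qed.

Lemma is_norm_continuous N : is_norm N -> continuous N.
Proof.
move=> NN; have [C C0 NC] := is_norm_le_mx_norm NN.
move=> v; apply/(@cvgrPdist_le _ _ _ (nbhs v) (nbhs_filter v)) => e e0.
have eC0 : 0 < e / (C + 1) by rewrite divr_gt0// ltr_wpDl.
have := @cvgr_dist_le _ _ _ (nbhs v) (nbhs_filter v) id v cvg_id _ eC0.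
apply: (@filterS _ (nbhs v) (nbhs_filter v)) => u vu.
rewrite (le_trans (is_norm_dist _ _ NN))// (le_trans (NC _))//.
rewrite (@le_trans _ _ ((C + 1) * `|v - u|))// ?ler_wpM2r// ?lerDl//.
by rewrite mulrC -ler_pdivlMr ?ltr_wpDl.
Qed.

(** The unit sphere of the max norm is compact and N is continuous and positive on it, so N has a
    positive minimum there; C is its inverse. *)
Lemma mx_norm_le_is_norm N : is_norm N ->
  exists2 C, 0 <= C & forall v, `|v| <= C * N v.
Proof.
move=> NN; have [_ NZ Nd] := NN.
(* The extreme value theorem is applied to row vectors; transposition, an isometry, carries the
   result to columns. *)
have nT (u : 'rV[R]_d) : `|u^T| = `|u|.
  rewrite /Num.norm/= !mx_normrE; apply/eqP; rewrite eq_le; apply/andP; split.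
    apply/bigmax_leP; split=> [|[i j] _]; first exact: bigmax_ge_id.
    rewrite mxE/=; exact: (@le_bigmax _ _ _ _ (fun ij => `|u ij.1 ij.2|) (j, i)).
  apply/bigmax_leP; split=> [|[i j] _]; first exact: bigmax_ge_id.
  have -> : u i j = u^T j i by rewrite mxE.
  exact: (@le_bigmax _ _ _ _ (fun ij => `|u^T ij.1 ij.2|) (j, i)).
pose S := [set u : 'rV[R]_d | `|u| = 1].
have cT : continuous (fun u : 'rV[R]_d => u^T).
  move=> u; apply/(@cvgrPdist_le _ _ _ (nbhs u) (nbhs_filter u)) => e e0.
  have := @cvgr_dist_le _ _ _ (nbhs u) (nbhs_filter u) id u cvg_id _ e0.
  apply: (@filterS _ (nbhs u) (nbhs_filter u)) => w uw.
  by rewrite -linearB/= nT.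
(* An empty sphere, as for d = 0, forces every vector to be zero. *)
have [S0|/set0P S0] := eqVneq S set0.
  exists 0 => // v; rewrite mul0r; apply: contrapT => /negP; rewrite -ltNge => v0.
  suff : S (`|v|^-1 *: v^T) by rewrite S0.
  rewrite /S/= normrZ -(nT v^T) trmxK normfV normr_id mulVf ?gt_eqF//.
have cS : compact S.
  apply: bounded_closed_compact.
    exists 1; split; first exact: num_real.
    by move=> x x1 u /= ->; rewrite ltW.
  apply: (@closed_comp _ _ (fun u : 'rV[R]_d => `|u|) [set 1]).
    by move=> u _; exact: norm_continuous.
  exact: closed_eq.
have cNT : {within S, continuous (fun u : 'rV[R]_d => N u^T)}.
  apply: continuous_subspaceT => u.
  apply: (@continuous_comp _ _ _ (fun u : 'rV[R]_d => u^T) N); first exact: cT.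
  exact: is_norm_continuous.
have [u0 /[!inE] u0S u0min] := EVT_min_rV S0 cS cNT.
have Nu0 : 0 < N u0^T.
  rewrite lt_neqAle is_norm_ge0// andbT eq_sym; apply/eqP => /Nd u00.
  by move: u0S; rewrite /S/= -nT u00 normr0 => /esym/eqP; rewrite oner_eq0.
exists (N u0^T)^-1; first by rewrite invr_ge0 ltW.
move=> v; have [->|v0] := eqVneq v 0.
  by rewrite normr0 mulr_ge0 ?invr_ge0 ?is_norm_ge0.
rewrite ler_pdivlMl//.
have nv0 : 0 < `|v| by rewrite normr_gt0.
have : N u0^T <= N (`|v|^-1 *: v).
  rewrite -[_ *: v]trmxK; apply: u0min; rewrite inE /S/= -nT trmxK.
  by rewrite normrZ normfV normr_id mulVf ?gt_eqF.
by rewrite NZ normfV normr_id mulrC ler_pdivlMr.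
Qed.

(** Used to pass between the given norm and the adapted one; adding 1 makes the constant
    positive. *)
Lemma norm_equivalence N M : is_norm N -> is_norm M ->
  exists2 C, 0 < C & forall v, N v <= C * M v.
Proof.
move=> /is_norm_le_mx_norm[C C0 NC] MM.
have [D D0 MD] := mx_norm_le_is_norm MM.
exists (C * D + 1); first by rewrite ltr_wpDl// mulr_ge0.
move=> v; rewrite (le_trans (NC v))//.
rewrite mulrDl mul1r ler_wpDr ?is_norm_ge0// -mulrA ler_wpM2l//.
Qed.

End norms.

(** * The Lebesgue sigma-algebra and translation invariance *)

Section lebesgue.
Context {R : realType}.
Local Notation hl := (wlength (@idfun R)).
Local Notation L := (lebesgueType R).

Lemma leb_subset_null (A B : set L) : leb B = 0%E -> measurable B -> A `<=` B ->
  measurable A.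
Proof.
move=> B0 mB AB; apply: completed_lebesgue_measure_is_complete.
by exists B; split.
Qed.

(** The Caratheodory sigma-algebra is the completion of the Borel one. *)
Lemma leb_borel_null (A : set L) : measurable A ->
  exists B N Z : set R,
    [/\ measurable B, measurable Z, N `<=` Z, leb Z = 0%E & A = B `|` N].
Proof.
move=> mA.
have : (completed_algebra_gen (@lebesgue_measure R)).-sigma.-measurable A.
  by rewrite completed_caratheodory_measurable.
rewrite g_sigma_completed_algebra_genE => -[B mB [N [Z [mZ Z0 NZ]]] <-].
exists B, N, Z; split => //.
Qed.

Lemma measurable_leb (A : set R) : measurable A -> measurable (A : set L).
Proof. by move=> mA; apply: sub_caratheodory. Qed.

(* The Borel-measurable f pulls back the Borel part of a Lebesgue set, and the
   null part is handled by completeness. *)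
Lemma measurable_fun_leb (D : set L) (f : L -> L) : measurable D ->
  measurable_fun D (f : L -> R) ->
  (forall Z, measurable Z -> leb Z = 0%E -> leb (D `&` f @^-1` Z) = 0%E) ->
  measurable_fun D f.
Proof.
move=> mD mf f0 _ Y /leb_borel_null[B [N [Z [mB mZ NZ Z0 ->]]]].
rewrite preimage_setU setIUr; apply: measurableU; first exact: mf.
apply: (@leb_subset_null _ (D `&` f @^-1` Z)).
- by apply: f0 => //; exact: measurable_leb.
- exact: mf.
- by move=> t [Dt /NZ]; split.
Qed.

(* The Lebesgue outer measure is an infimum over covers by these intervals. *)
Lemma wlength_shift (a : R) (I : set R) : R.-ocitv.-measurable I ->
  R.-ocitv.-measurable [set (x + a)%R | x in I] /\
  hl [set (x + a)%R | x in I] = hl I.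
Proof.
move=> [[b c] _ <-]/=.
have -> : [set (x + a)%R | x in `]b, c]] = `](b + a), (c + a)]%classic.
  apply/seteqP; split=> [_ [x + <-]|x]/=; rewrite !in_itv/= ?ltrD2r ?lerD2r//.
  by move=> xbc; exists (x - a); rewrite ?subrK// in_itv/= ltrBrDr lerBlDr.
split; first by exists (b + a, c + a).
rewrite !wlength_itv/= !lte_fin ltrD2r; case: ifP => // _.
by rewrite -!EFinB opprD addrACA subrr addr0.
Qed.

(** A shifted interval cover has the same total length. X is arbitrary because Caratheodory's
    criterion, used below, tests all sets. *)
Lemma leb_shift_le (a : R) (X : set R) :
  (leb [set (x + a)%R | x in X] <= leb X)%E.
Proof.
apply: le_ereal_inf_tmp => _ [F [mF XF] <-].
apply: ereal_inf_lbound; exists (fun k => [set (x + a)%R | x in F k]).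
  split=> [k|_ [x Xx <-]]; first exact: (wlength_shift a (mF k)).1.
  by have [k _ Fkx] := XF _ Xx; exists k => //; exists x.
by apply: eq_eseriesr => k _; exact: (wlength_shift a (mF k)).2.
Qed.

Lemma leb_shift (a : R) (X : set R) : leb [set (x + a)%R | x in X] = leb X.
Proof.
apply/eqP; rewrite eq_le leb_shift_le/=.
have {1}-> : X = [set (x - a)%R | x in [set (x + a)%R | x in X]].
  by rewrite image_comp -[LHS]image_id; apply: eq_imagel => x _ /=; rewrite addrK.
exact: leb_shift_le.
Qed.

Lemma leb_preimage_shift (a : R) (X : set R) :
  leb ((fun x => x + a) @^-1` X) = leb X.
Proof.
rewrite -[RHS](leb_shift (- a)); congr (leb _).
apply/seteqP; split=> [x Xx|_ [x Xx <-]]; last by rewrite /= subrK.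
by exists (x + a); rewrite ?addrK.
Qed.

Lemma leb_measurableP (Y : set L) : measurable Y <->
  forall X : set R, (leb X = leb (X `&` Y) + leb (X `&` ~` Y))%E.
Proof. by []. Qed.

(** The outer measure of every set is translation invariant, so a test set X for the preimage of Y
    can be traded for the shifted test set X' for Y. *)
Lemma measurable_shift (a : R) :
  measurable_fun setT ((fun x => x + a) : L -> L).
Proof.
move=> _ Y /leb_measurableP mY; rewrite setTI; apply/leb_measurableP => X.
pose X' := (fun x => x - a) @^-1` X.
have XE : X = (fun x => x + a) @^-1` X'.
  by apply/funext => x; rewrite /X' /preimage/= addrK.
rewrite {2 3}XE preimage_setC -!preimage_setI !leb_preimage_shift.
by rewrite {1}XE leb_preimage_shift.
Qed.

Lemma ge0_integral_shift (a : R) (f : L -> \bar R) : measurable_fun setT f ->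
  (forall x, 0 <= f x)%E ->
  (\int[leb]_x f (x + a)%R = \int[leb]_x f x)%E.
Proof.
move=> mf f0.
rewrite -(@ge0_integral_pushforward _ _ _ _ _ _ (measurable_shift a) leb setT)//.
apply: (@eq_measure_integral _ _ _ _ leb) => [|mshift A mA _]; first exact: measurable_shift.
exact: leb_preimage_shift.
Qed.

Lemma ae_le_Lnormy (f : L -> \bar R) :
  {ae leb, forall x : L, (`|f x| <= 'N[leb]_+oo[f])%E}.
Proof.
rewrite unlock; case: ifPn => [_|]; first exact: ess_sup_ge.
(* If the whole space were null, the norm would take a default value, and any property would hold
   almost everywhere. *)
rewrite -leNgt => T0; exists setT; split=> //.
by apply/eqP; rewrite eq_le T0 measure_ge0.
Qed.

(** * Change of variables along sigma_1 *)

Section pushforward.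
Variables (tau phi : R -> R).
Hypothesis tau_meas : measurable_fun (`[0, +oo[ : set L) (tau : L -> L).
Hypothesis sigma1_null : forall Z : set L, measurable Z ->
  leb Z = 0%E -> leb (`[0, +oo[ `&` sigma1 tau @^-1` Z) = 0%E.
Hypothesis phi_RN : is_RN_derivative (sigma1_pushforward tau) phi.

(** As a difference, [sigma1] pulls Borel sets back to Lebesgue sets; the condition on null sets
    extends this to all Lebesgue sets. *)
Lemma measurable_sigma1 :
  measurable_fun (`[0, +oo[ : set L) (sigma1 tau : L -> L).
Proof.
apply: measurable_fun_leb => //; first exact: measurable_Rplus.
apply: measurable_funB => [_ B mB|mD B mB].
  by apply: measurableI; [exact: measurable_Rplus|exact: measurable_leb].
by apply: tau_meas => //; exact: measurable_leb.
Qed.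

Lemma sigma1_pushforward_le (K : R) : 0 <= K ->
  {ae leb, forall s : L, phi s <= K} ->
  forall B : set L, measurable B ->
    (sigma1_pushforward tau B <= K%:E * leb B)%E.
Proof.
move=> K0 phiK B mB; have [mphi phi0 ->//] := phi_RN.
rewrite -integral_cst//; apply: ae_ge0_le_integral.
- exact: mB.
- by move=> x _; rewrite lee_fin.
- by apply/measurable_EFinP; exact: measurable_funTS.
- by move=> x _; rewrite lee_fin.
- exact: measurable_cst.
- by apply: filterS phiK => x xK _; rewrite lee_fin.
Qed.

(** The left-hand integral is that of f against the push-forward, a measure dominated by K times
    [leb]. *)
Lemma integral_sigma1_le (K : R) (f : L -> \bar R) : 0 <= K ->
  {ae leb, forall s : L, phi s <= K} ->
  measurable_fun setT f -> (forall s, 0 <= f s)%E ->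
  (\int[leb]_(t in `[0%R, +oo[) f (sigma1 tau t) <= K%:E * \int[leb]_s f s)%E.
Proof.
move=> K0 phiK mf f0.
(* sigma1 is only measurable on [0, +oo[, whereas the library's change of
   variables requires a map measurable on the whole line. *)
pose S : L -> L := (sigma1 tau : L -> L) \_ `[0, +oo[.
have mS : measurable_fun setT S.
  by apply/(measurable_restrictT _ measurable_Rplus); exact: measurable_sigma1.
have SE (t : R) : t \in `[0, +oo[%classic -> S t = sigma1 tau t.
  by move=> t0; rewrite /S patchE t0.
have mfS : measurable_fun setT (f \o S) by exact: measurableT_comp.
apply: (@le_trans _ _
  (\int[mrestr leb measurable_Rplus]_(t in `[0%R, +oo[) (f (S t)))%E).
  rewrite [leRHS](_ : _ = \int[leb]_(t in `[0%R, +oo[) (f (S t)))%E; last first.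
    apply: eq_measure_integral => A mA A0.
    rewrite -[LHS]/(leb (A `&` `[0, +oo[)); congr (leb _); exact: setIidl.
  by rewrite le_eqVlt; apply/orP; left; apply/eqP/eq_integral => t /SE ->.
apply: (@le_trans _ _ (\int[mrestr leb measurable_Rplus]_t (f (S t)))%E).
  by apply: ge0_subset_integral => //; exact: measurable_Rplus.
rewrite -(@ge0_integral_pushforward _ _ _ _ _ _ mS _ setT)//.
rewrite -(@ge0_integral_mscale _ _ _ _ _ _ (NngNum K0))//.
apply: ge0_le_measure_integral => // B mB.
apply: le_trans (sigma1_pushforward_le K0 phiK mB).
rewrite -[leLHS]/(leb (S @^-1` B `&` `[0, +oo[)).
rewrite -[leRHS]/(leb (sigma1 tau @^-1` B `&` `[0, +oo[)).
rewrite le_eqVlt; apply/orP; left; apply/eqP; congr (leb _).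
apply/seteqP; split=> t [] + t0; rewrite /preimage/= SE ?inE//.
Qed.

End pushforward.
End lebesgue.

(** The strict inequality leaves room: for K > 0, r^p is taken midway between rho(A)^p and 1/K. *)
Lemma adapted_rate (R : realType) (d : nat) (A : 'M[R]_d) (p K : R) :
  (0 < d)%N -> 1 <= p -> 0 <= K -> K * spectral_radius A `^ p < 1 ->
  exists r, [/\ 0 <= r, spectral_radius A < r & K * r `^ p < 1].
Proof.
move=> d0 p1 K0; set rho := spectral_radius A => Krho.
have p0 : 0 < p by exact: lt_le_trans p1.
(* As d > 0, there is a complex eigenvalue, whose modulus is at most rho(A). *)
have rho0 : 0 <= rho.
  have [z Az] := eigenvalue_closed (map_mx (real_complex R) A) d0.
  by rewrite (le_trans (cmod_ge0 z))// le_spectral_radius.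
have [->|Kn0] := eqVneq K 0.
  by exists (rho + 1); rewrite mul0r ltr01 ltrDl ltr01 addr_ge0.
have Kgt0 : 0 < K by rewrite lt_neqAle eq_sym Kn0.
pose m := (rho `^ p + K^-1) / 2.
have rhoK : rho `^ p < K^-1 by rewrite -[ltRHS]mulr1 ltr_pdivlMl.
have m0 : 0 <= m by rewrite divr_ge0// addr_ge0 ?powR_ge0// invr_ge0.
have mE : (m `^ p^-1) `^ p = m by rewrite -powRrM mulVf ?gt_eqF// powRr1.
exists (m `^ p^-1); rewrite powR_ge0 mE; split => //.
  rewrite ltNge; apply/negP => /(ge0_ler_powR (ltW p0)).
  by rewrite !nnegrE powR_ge0 mE => /(_ isT rho0); rewrite leNgt midf_lt.
by rewrite -ltr_pdivlMl// mulr1 midf_lt.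
Qed.

(** * Vector-valued L^p norms *)

Section Lp.
Context {R : realType} {d : nat}.
Local Notation L := (lebesgueType R).
Implicit Types (N M : 'cV[R]_d -> R) (D E : set L) (f x : R -> 'cV[R]_d).

Lemma measurable_lco (a b : \bar R) : measurable (lco a b : set L).
Proof.
apply: measurable_leb.
have -> : lco a b = setT `&` EFin @^-1` [set` `[a, b[].
  by rewrite setTI; apply/seteqP; split => s; rewrite /lco/= in_itv.
exact: (EFin_measurable measurableT (emeasurable_itv `[a, b[)).
Qed.

(** The rays ]y, +oo[ generate the Borel sets, and their preimages by the continuous N are open. *)
Lemma measurable_norm_comp N D f : is_norm N -> measurable D ->
  borel_measurable_on D f -> measurable_fun D (N \o f : L -> R).
Proof.
move=> NN mD mf.
apply: (measurability _ (RGenOInfty.measurableE R)) => _ [_ [y ->] <-].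
rewrite -[_ @^-1` _]/(f @^-1` (N @^-1` `]y, +oo[)).
apply: mf; apply: sub_sigma_algebra => /=.
apply: open_comp => [v _|]; first exact: is_norm_continuous.
exact: rray_open.
Qed.

Variable p : R.
Hypothesis p_gt0 : 0 < p.

Lemma measurable_norm_powR N D E f : is_norm N -> measurable D ->
  borel_measurable_on D f -> measurable E -> E `<=` D ->
  measurable_fun E (fun s : L => (N (f s) `^ p)%:E).
Proof.
move=> NN mD mf mE ED; apply/measurable_EFinP.
apply: (measurable_funS mD ED).
apply: (@measurableT_comp _ _ _ _ _ _ (fun a : R => a `^ p)).
  exact: measurable_powR.
exact: measurable_norm_comp.
Qed.

Lemma Lp_normE N E f : is_norm N ->
  Lp_norm N p E f = ((\int[leb]_(s in E) (N (f s) `^ p)%:E) `^ p^-1)%E.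
Proof.
move=> NN; rewrite /Lp_norm unlock [in RHS]integral_mkcond; congr (_ `^ _)%E.
apply: eq_integral => s _; rewrite !patchE; case: ifPn => _ /=.
  by rewrite ger0_norm ?is_norm_ge0.
(* Off [E] the integrand is 0 to the power p, which vanishes because p is nonzero. *)
by rewrite normr0 powR0// gt_eqF.
Qed.

Lemma Lp_norm_lty N E f : is_norm N ->
  (Lp_norm N p E f < +oo)%E <->
  (\int[leb]_(s in E) (N (f s) `^ p)%:E < +oo)%E.
Proof.
move=> NN; rewrite Lp_normE//; split; last exact: poweR_lty.
by apply: lty_poweRy; rewrite invr_neq0// gt_eqF.
Qed.

(** From M <= C N, the integral of M(f)^p is at most C^p times that of N(f)^p. *)
Lemma Lp_norm_change N M D E f : is_norm N -> is_norm M -> measurable D ->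
  borel_measurable_on D f -> measurable E -> E `<=` D ->
  (Lp_norm N p E f < +oo)%E -> (Lp_norm M p E f < +oo)%E.
Proof.
move=> NN MM mD mf mE ED; have [C C0 MN] := norm_equivalence MM NN.
move=> /(Lp_norm_lty _ _ NN) Nf; apply/(Lp_norm_lty _ _ MM).
apply: (@le_lt_trans _ _
  ((C `^ p)%:E * \int[leb]_(s in E) (N (f s) `^ p)%:E)%E).
  rewrite -ge0_integralZl_EFin; last exact: powR_ge0; last 3 first.
  - exact: mE.
  - by move=> s _; rewrite lee_fin powR_ge0.
  - exact: measurable_norm_powR NN mD mf mE ED.
  apply: ge0_le_integral.
  - exact: mE.
  - by move=> s _; rewrite lee_fin powR_ge0.
  - exact: measurable_norm_powR MM mD mf mE ED.
  - apply: emeasurable_funM; first exact: measurable_cst.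
    exact: measurable_norm_powR NN mD mf mE ED.
  - move=> s _; rewrite -EFinM lee_fin -powRM ?is_norm_ge0 ?(ltW C0)//.
    rewrite ge0_ler_powR ?(ltW p_gt0)// nnegrE ?mulr_ge0 ?is_norm_ge0//.
    exact: ltW.
rewrite lte_mul_pinfty ?lee_fin ?powR_ge0//.
Qed.

End Lp.

(** * Domains of the delay equation and the a priori bound *)

Section delay.
Context {R : realType}.
Local Notation L := (lebesgueType R).
Variable tau : R -> R.

(* t - h(t) *)
Definition sigma1_inf (t : R) : \bar R :=
  ereal_inf [set (sigma1 tau s)%:E | s in `[t, +oo[%classic].

Lemma sigma1_inf_le (t s : R) : t <= s -> (sigma1_inf t <= (sigma1 tau s)%:E)%E.
Proof.
by move=> ts; apply: ereal_inf_lbound; exists s => //=; rewrite in_itv/= ts.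
Qed.

Lemma sigma1_inf_homo (t s : R) : t <= s -> (sigma1_inf t <= sigma1_inf s)%E.
Proof.
move=> ts; apply: ereal_inf_le_tmp => _ [u /= + <-]; rewrite in_itv/= andbT => su.
by exists u => //; rewrite /= in_itv/= andbT (le_trans ts).
Qed.

(** As t - h(t) = [sigma1_inf t], translation by t carries |-h(t), 0) to |t - h(t), t); h(t) may be
    infinite, hence the case analysis. *)
Lemma lco_historyE (t : R) :
  lco (- largest_delay tau t) 0 =
  (fun s => s + t) @^-1` lco (sigma1_inf t) t%:E.
Proof.
rewrite /largest_delay -/(sigma1_inf t); apply/seteqP.
have E s : (- (t%:E - sigma1_inf t) <= s%:E)%E = (sigma1_inf t <= (s + t)%:E)%E.
  case: (sigma1_inf t) => [m| |] //=.
    by rewrite !lee_fin opprB lerBlDr.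
  by rewrite !leNye.
by split=> s; rewrite /lco/= !lte_fin E -(ltrD2r t s) add0r.
Qed.

Lemma solution_domainE : solution_domain tau = lco (sigma1_inf 0) +oo.
Proof.
rewrite /solution_domain /largest_delay -/(sigma1_inf 0); congr lco.
by case: (sigma1_inf 0) => [m| |] //=; rewrite opprB subr0.
Qed.

Lemma lco_pastE : lco (- largest_delay tau 0) 0 = lco (sigma1_inf 0) 0.
Proof. by rewrite lco_historyE; apply/funext => s; rewrite /preimage/= addr0. Qed.

Hypothesis tau_delay : delay_function tau.

Lemma sigma1_lt (t : R) : 0 <= t -> sigma1 tau t < t.
Proof. by move=> t0; rewrite /sigma1 ltrBlDr ltrDl tau_delay. Qed.

Lemma sigma1_inf0_lt0 : (sigma1_inf 0 < 0)%E.
Proof.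
by rewrite (le_lt_trans (sigma1_inf_le (lexx 0)))// lte_fin sigma1_lt.
Qed.

Lemma domain_ge0 (t : R) : 0 <= t -> lco (sigma1_inf 0) +oo t.
Proof.
move=> t0; rewrite /lco/= ltry andbT (le_trans (ltW sigma1_inf0_lt0))//.
Qed.

Context {d : nat}.
Variables (M : 'cV[R]_d -> R) (A : 'M[R]_d) (x : R -> 'cV[R]_d).
Variables (p r K : R) (phi : R -> R).
Hypothesis M_norm : is_norm M.
Hypothesis AM : forall v, M (A *m v) <= r * M v.
Hypothesis p_gt0 : 0 < p.
Hypothesis r_ge0 : 0 <= r.
Hypothesis K_ge0 : 0 <= K.
Hypothesis tau_meas : measurable_fun (`[0, +oo[ : set L) (tau : L -> L).
Hypothesis sigma1_null : forall Z : set L, measurable Z ->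
  leb Z = 0%E -> leb (`[0, +oo[ `&` sigma1 tau @^-1` Z) = 0%E.
Hypothesis phi_RN : is_RN_derivative (sigma1_pushforward tau) phi.
Hypothesis phi_le : {ae leb, forall s : L, phi s <= K}.
Hypothesis x_meas : borel_measurable_on (lco (sigma1_inf 0) +oo) x.
Hypothesis x_eq : {ae leb, forall t : L, 0 <= t -> x t = A *m x (t - tau t)}.

Let D : set L := lco (sigma1_inf 0) +oo.
Let G (s : L) : \bar R := (M (x s) `^ p)%:E.

Let mD : measurable D. Proof. exact: measurable_lco. Qed.

Let G0 s : (0 <= G s)%E. Proof. by rewrite lee_fin powR_ge0. Qed.

Let mG E : measurable E -> E `<=` D -> measurable_fun E G.
Proof. exact: (measurable_norm_powR p M_norm mD x_meas). Qed.

Let mitv (i : interval R) : measurable ([set` i] : set L).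
Proof. exact: measurable_leb (measurable_itv _). Qed.

Let nonneg_sub (E : set L) : (forall s, E s -> 0 <= s) -> E `<=` D.
Proof. by move=> E0 s /E0; exact: domain_ge0. Qed.

Lemma Lp_contraction (T : R) : 0 <= T ->
  (\int[leb]_(s in `[0%R, T]) G s <= (K * r `^ p)%:E *
    (\int[leb]_(s in lco (sigma1_inf 0) 0) G s +
     \int[leb]_(s in `[0%R, T]) G s))%E.
Proof.
move=> T0.
pose P : set L := lco (sigma1_inf 0) 0.
pose I : set L := `[0, T]%classic.
have mP : measurable P by exact: measurable_lco.
have mI : measurable I by exact: mitv.
have PD : P `<=` D.
  by move=> s; rewrite /P/D/lco/= ltry andbT => /andP[].
have ID : I `<=` D by apply: nonneg_sub => s; rewrite /I/= in_itv/= => /andP[].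
have PID : P `|` I `<=` D by rewrite subUset.
have mPI : measurable (P `|` I) by exact: measurableU.
(* With G cut off outside the past and [0, T], the change of variables over all of [0, +oo[ gives
   back just the two integrals. *)
pose g : L -> \bar R := G \_ (P `|` I).
have mg : measurable_fun setT g.
  by apply/(measurable_restrictT _ mPI); exact: mG.
have g0 s : (0 <= g s)%E by rewrite /g patchE; case: ifP.
have gE (t : R) : I t -> g (sigma1 tau t) = G (sigma1 tau t).
  rewrite /I/= in_itv/= => /andP[t0 tT]; rewrite /g patchE ifT// inE.
  have [s0|s0] := ltP (sigma1 tau t) 0.
    by left; rewrite /P/lco/= lte_fin s0 sigma1_inf_le.
  by right; rewrite /I/= in_itv/= s0 (le_trans (ltW (sigma1_lt t0))).
have I0 : I `<=` `[0, +oo[%classic.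
  by move=> s; rewrite /I/= !in_itv/= andbT => /andP[].
have mgs0 : measurable_fun (`[0, +oo[%classic : set L)
    ((g \o sigma1 tau) : L -> \bar R).
  apply: (@measurableT_comp _ _ _ L L _ g) => //.
  exact: (measurable_sigma1 tau_meas sigma1_null).
have mgs : measurable_fun I ((g \o sigma1 tau) : L -> \bar R).
  by apply: measurable_funS mgs0 => //; exact: mitv.
have rp0 : 0 <= r `^ p by exact: powR_ge0.
(* This inequality comes from the equation satisfied a.e. by x and from M(A v) <= r M(v). *)
apply: (@le_trans _ _ ((r `^ p)%:E * \int[leb]_(t in I) g (sigma1 tau t))%E).
  rewrite -ge0_integralZl_EFin//.
  apply: ae_ge0_le_integral.
  - exact: mI.
  - by move=> t _; exact: G0.
  - exact: mG.
  - by move=> t _; rewrite mule_ge0.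
  - by apply: emeasurable_funM; [exact: measurable_cst|exact: mgs].
  apply: filterS x_eq => t xt It; rewrite gE//.
  move: It; rewrite /I/= in_itv/= => /andP[t0 tT].
  rewrite /G xt// -EFinM lee_fin -powRM ?is_norm_ge0//.
  by rewrite ge0_ler_powR ?(ltW p_gt0) ?nnegrE ?mulr_ge0 ?is_norm_ge0.
rewrite mulrC EFinM -muleA lee_wpmul2l//.
apply: (@le_trans _ _ (\int[leb]_(t in `[0%R, +oo[) g (sigma1 tau t))%E).
  by apply: ge0_subset_integral => //; exact: mitv.
apply: (le_trans (integral_sigma1_le tau_meas sigma1_null phi_RN K_ge0
  phi_le mg g0)).
rewrite lee_wpmul2l//.
rewrite -integral_mkcond ge0_integral_setU//; first exact: mG.
rewrite disj_set2E; apply/eqP/seteqP; split=> // s [].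
by rewrite /P/I/lco/= in_itv/= lte_fin => /andP[_ /lt_geF ->].
Qed.

(** With q = K r^p, the contraction I_T <= q (J + I_T) gives I_T <= q J / (1 - q), uniformly in
    T. *)
Lemma Lp_bound : K * r `^ p < 1 ->
  (\int[leb]_(s in lco (sigma1_inf 0) 0) G s < +oo)%E ->
  (forall T : R, (0 <= T)%R -> \int[leb]_(s in `[0%R, T]) G s < +oo)%E ->
  (\int[leb]_(s in D) G s < +oo)%E.
Proof.
move=> q1 Joo Ioo; set q := K * r `^ p in q1.
have q0 : 0 <= q by rewrite mulr_ge0 ?powR_ge0.
set J := (X in (X < +oo)%E) in Joo.
have J0 : (0 <= J)%E by apply: integral_ge0.
have Jfin : J \is a fin_num by rewrite ge0_fin_numE.
have IJ (T : R) : 0 <= T ->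
    (\int[leb]_(s in `[0%R, T]) G s <= (q * fine J / (1 - q))%:E)%E.
  move=> T0; have := Lp_contraction T0; rewrite -/J -/q.
  (* Finiteness of I_T is what allows q I_T to be subtracted. *)
  have := Ioo _ T0.
  have : (0 <= \int[leb]_(s in `[0%R, T]) G s)%E by exact: integral_ge0.
  rewrite -(fineK Jfin); case: (integral _ _ _) => // a a0 _.
  rewrite -EFinD -EFinM !lee_fin mulrDr => aq.
  rewrite ler_pdivlMr ?subr_gt0// mulrBr mulr1 lerBlDr.
  by rewrite mulrC [a * q]mulrC (mulrC _ q).
have DE : D = lco (sigma1_inf 0) 0 `|` `[0, +oo[%classic.
  apply/seteqP; split=> [s|s [|]].
  - rewrite /D/lco/= => /andP[ms _]; have [s0|s0] := ltP s 0.
      by left; rewrite ms lte_fin.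
    by right; rewrite in_itv/= s0.
  - by rewrite /D/lco/= ltry => /andP[->].
  - by rewrite /= in_itv/= andbT; exact: domain_ge0.
rewrite DE ge0_integral_setU//.
- rewrite -/J lte_add_pinfty// (@le_lt_trans _ _ (q * fine J / (1 - q))%:E) ?ltry//.
  (* Monotone convergence along [0, n] carries the uniform bound to [0, +oo[. *)
  have -> : `[0, +oo[%classic = \bigcup_n `[0, n%:R]%classic :> set L.
    apply/seteqP; split=> [s|s [n _]] /=; rewrite !in_itv/= andbT.
      move=> s0; exists (Num.truncn s).+1 => //=; rewrite in_itv/= s0/=.
      by rewrite ltW// truncnS_gt.
    by move=> /andP[].
  have IF n : (`[0, n%:R]%classic : set L) `<=` D.
    by apply: nonneg_sub => s; rewrite /= in_itv/= => /andP[].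
  have cvgI : (fun n => \int[leb]_(s in `[0%R, n%:R]) G s)%E @ \oo -->
      (\int[leb]_(s in \bigcup_n `[0%R, n%:R]%classic) G s)%E.
    apply: ge0_nondecreasing_set_cvg_integral => //.
      move=> n m nm; apply/subsetPset => s; rewrite /= !in_itv/= => /andP[->/= sn].
      by rewrite (le_trans sn)// ler_nat.
    by move=> n; exact: mG.
  by apply: (cvge_le _ cvgI); apply: nearW => n; exact: IJ.
- exact: measurable_lco.
- rewrite -DE; exact: mG.
rewrite disj_set2E; apply/eqP/seteqP; split=> // s [].
by rewrite /lco/= in_itv/= lte_fin => /andP[_ /lt_geF ->].
Qed.

End delay.

(** * Vanishing tails and the decay of x_t *)

(** If every tail were at least e, the integrals over [0, n[ would be at most I - e, whereas they
    converge to the finite I. *)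
Lemma integral_tail_lt (R : realType) (f : lebesgueType R -> \bar R) (e : R) :
  measurable_fun (`[0%R, +oo[%classic : set (lebesgueType R)) f ->
  (forall s, 0 <= f s)%E ->
  (\int[leb]_(s in `[0%R, +oo[) f s < +oo)%E -> 0 < e ->
  exists n : nat, (\int[leb]_(s in `[n%:R, +oo[) f s < e%:E)%E.
Proof.
set L := lebesgueType R => mf f0 foo e0.
have mitv (i : interval R) : measurable ([set` i] : set L).
  exact: measurable_leb (measurable_itv _).
apply: contrapT => /forallNP tail.
have tail' n : (e%:E <= \int[leb]_(s in `[n%:R, +oo[) f s)%E.
  by rewrite leNgt; apply/negP.
have UE : `[0, +oo[%classic = \bigcup_n `[0, n%:R[%classic :> set L.
  apply/seteqP; split=> [s|s [n _]] /=; rewrite !in_itv/= andbT.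
    move=> s0; exists (Num.truncn s).+1 => //=; rewrite in_itv/= s0/=.
    by rewrite truncnS_gt.
  by move=> /andP[].
have mfs (F : set L) :
    measurable F -> F `<=` `[0, +oo[%classic -> measurable_fun F f.
  by move=> mF F0; apply: measurable_funS mf => //; exact: mitv.
have sub0 (n : nat) : (`[0, n%:R[%classic : set L) `<=` `[0, +oo[%classic.
  by move=> s; rewrite /= !in_itv/= andbT => /andP[].
set I := (X in (X < _)%E) in foo.
have Ifin : I \is a fin_num.
  by rewrite ge0_fin_numE//; apply: integral_ge0.
have splitI (n : nat) : (I = \int[leb]_(s in `[0%R, n%:R[) f s +
    \int[leb]_(s in `[n%:R, +oo[) f s)%E.
  have nU : `[0, +oo[%classic =
      `[0, n%:R[%classic `|` `[n%:R, +oo[%classic :> set L.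
    apply/seteqP; split=> s /=; rewrite !in_itv/= !andbT.
      by move=> s0; have [sn|sn] := ltP s n%:R; [left; rewrite s0|right].
    by move=> [/andP[]//|]; exact: le_trans.
  rewrite /I nU ge0_integral_setU//.
  - by rewrite -nU.
  - rewrite disj_set2E; apply/eqP/seteqP; split=> // s [] /=.
    by rewrite !in_itv/= andbT => /andP[_ /lt_geF ->].
have cvgI : (fun n => \int[leb]_(s in `[0%R, n%:R[) f s)%E @ \oo --> I.
  rewrite /I UE; apply: ge0_nondecreasing_set_cvg_integral => //.
    move=> n m nm; apply/subsetPset => s; rewrite /= !in_itv/= => /andP[->/= sn].
    by rewrite (lt_le_trans sn)// ler_nat.
  by move=> n; exact: mfs.
have : (I <= I - e%:E)%E.
  apply: (cvge_le _ cvgI); apply: nearW => n.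
  by rewrite leeBrDr// (splitI n) leeD2l.
by rewrite leNgt lteBlDr// lteDl// lte_fin e0.
Qed.

Section history.
Context {R : realType} {d : nat}.
Local Notation L := (lebesgueType R).

Lemma Lp_norm_history (N : 'cV[R]_d -> R) (p : R) (tau : R -> R)
    (x : R -> 'cV[R]_d) (t : R) :
  is_norm N -> 0 < p -> 0 <= t ->
  borel_measurable_on (lco (sigma1_inf tau 0) +oo) x ->
  Lp_norm N p (lco (- largest_delay tau t) 0) (history x t) =
  ((\int[leb]_(s in lco (sigma1_inf tau t) t%:E) (N (x s) `^ p)%:E) `^ p^-1)%E.
Proof.
move=> NN p0 t0 mx; rewrite (Lp_normE p0 _ _ NN); congr (_ `^ _)%E.
set E := lco (sigma1_inf tau t) t%:E.
have mE : measurable (E : set L) by exact: measurable_lco.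
(* [sigma1_inf] is nondecreasing, so |t - h(t), t) lies in the domain, where x is measurable. *)
have ED : E `<=` lco (sigma1_inf tau 0) +oo.
  move=> s; rewrite /E/lco/= ltry andbT => /andP[+ _].
  exact/le_trans/sigma1_inf_homo.
rewrite lco_historyE integral_mkcond [RHS]integral_mkcond.
rewrite -[RHS](@ge0_integral_shift _ t).
- apply: eq_integral => s _.
  rewrite !patchE /history; congr (if _ then _ else _).
  by rewrite addrC.
- apply/(measurable_restrictT _ mE).
  exact: (measurable_norm_powR p NN (measurable_lco _ _) mx).
- by move=> s; rewrite patchE; case: ifP => // _; rewrite lee_fin powR_ge0.
Qed.

End history.

Theorem theorem5p7 (R : realType) (d : nat) (d_gt0 : (0 < d)%N)
  (N : 'cV[R]_d -> R) (N_norm : is_norm N)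
  (p : R) (p_ge1 : 1 <= p) (A : 'M[R]_d)
  (tau : R -> R) (tau_delay : delay_function tau)
  (tau_inf : forall t : R, 0 <= t -> 0 < inf [set tau s | s in `[0, t]])
  (sigma1_oo : sigma1 tau t @[t --> +oo] --> +oo)
  (tau_meas : measurable_fun (`[0, +oo[ : set (lebesgueType R))
    (tau : lebesgueType R -> lebesgueType R))
  (sigma1_null : forall Z : set (lebesgueType R), measurable Z ->
    leb Z = 0%E -> leb (`[0, +oo[ `&` sigma1 tau @^-1` Z) = 0%E)
  (push_sfin : sigma_finite setT (sigma1_pushforward tau))
  (phi : R -> R) (phi_RN : is_RN_derivative (sigma1_pushforward tau) phi)
  (phi_bnd : ('N[leb]_+oo[EFin \o (phi : lebesgueType R -> R)] < +oo)%E)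
  (phi_rho : ('N[leb]_+oo[EFin \o (phi : lebesgueType R -> R)] *
    (spectral_radius A `^ p)%:E < 1)%E)
  (x : R -> 'cV[R]_d) (x_sol : Lp_solution N p A tau x)
  (x_init : in_Lp N p (lco (- largest_delay tau 0) 0) x) :
  in_Lp N p (solution_domain tau) x /\
  Lp_norm N p (lco (- largest_delay tau t) 0) (history x t)
    @[t --> +oo] --> 0%E.
Proof.
have p_gt0 : 0 < p by exact: lt_le_trans p_ge1.
set K := 'N[leb]_+oo[_]%E in phi_bnd phi_rho.
have K0 : (0 <= K)%E by exact: Lnorm_ge0.
have Kfin : K \is a fin_num by rewrite ge0_fin_numE.
have k0 : 0 <= fine K by exact: fine_ge0.
have phi_le : {ae leb, forall s : lebesgueType R, phi s <= fine K}.
  have := ae_le_Lnormy (EFin \o (phi : lebesgueType R -> R)).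
  apply: filterS => s; rewrite -/K -lee_fin fineK//=.
  by apply: le_trans; rewrite lee_fin ler_norm.
have [r [r0 rA Kr]] :
    exists r, [/\ 0 <= r, spectral_radius A < r & fine K * r `^ p < 1].
  by apply: adapted_rate => //; rewrite -lte_fin EFinM fineK.
have [M MN AM] := adapted_norm d_gt0 rA.
have [x_meas x_ae [_ x_loc]] := x_sol.
have [_ x_past] := x_init.
rewrite lco_pastE in x_past.
have Dx := solution_domainE tau.
rewrite Dx in x_meas x_loc *.
have mD := @measurable_lco R (sigma1_inf tau 0) +oo.
(* Among all the representatives in the definition of an a.e. solution, x itself is taken. *)
have x_eq : {ae leb, forall t : lebesgueType R,
    0 <= t -> x t = A *m x (t - tau t)}.
  by apply: x_ae; exact: nearW.
have nonneg_D (s : R) : 0 <= s -> lco (sigma1_inf tau 0) +oo s.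
  exact: domain_ge0.
have past_D : lco (sigma1_inf tau 0) 0 `<=` lco (sigma1_inf tau 0) +oo.
  by move=> s; rewrite /lco/= ltry andbT => /andP[].
(* The a priori bound is in the adapted norm M, so finiteness over the past and over the compact
   [0, T] is first transferred from N to M. *)
have MD :
    (\int[leb]_(s in lco (sigma1_inf tau 0) +oo) (M (x s) `^ p)%:E < +oo)%E.
  apply: (Lp_bound tau_delay MN AM p_gt0 r0 k0 tau_meas sigma1_null phi_RN
    phi_le x_meas x_eq Kr).
    apply/(Lp_norm_lty p_gt0 _ _ MN).
    apply: (Lp_norm_change p_gt0 N_norm MN mD x_meas) => //.
    exact: measurable_lco.
  move=> T T0; apply/(Lp_norm_lty p_gt0 _ _ MN).
  have ITD : `[0, T]%classic `<=` lco (sigma1_inf tau 0) +oo.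
    by move=> s; rewrite /= in_itv/= => /andP[s0 _]; exact: nonneg_D.
  apply: (Lp_norm_change p_gt0 N_norm MN mD x_meas) => //.
    by apply: measurable_leb; exact: measurable_itv.
  by apply: x_loc => //; exact: segment_compact.
have ND : (Lp_norm N p (lco (sigma1_inf tau 0) +oo) x < +oo)%E.
  apply: (Lp_norm_change p_gt0 MN N_norm mD x_meas) => //.
  exact/(Lp_norm_lty p_gt0 _ _ MN).
split=> //.
move/(Lp_norm_lty p_gt0 _ _ N_norm) : (ND) => NDi.
have mf (E : set (lebesgueType R)) : measurable E ->
    E `<=` lco (sigma1_inf tau 0) +oo ->
    measurable_fun E (fun s : lebesgueType R => (N (x s) `^ p)%:E).
  exact: (measurable_norm_powR p N_norm mD x_meas).
have f0 (s : lebesgueType R) : (0 <= (N (x s) `^ p)%:E)%E.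
  by rewrite lee_fin powR_ge0.
have m0 (n : R) : measurable (`[n, +oo[%classic : set (lebesgueType R)).
  by apply: measurable_leb; exact: measurable_itv.
have sub0 (n : R) : 0 <= n -> `[n, +oo[%classic `<=` lco (sigma1_inf tau 0) +oo.
  move=> n0 s; rewrite /= in_itv/= andbT => ns.
  by apply: nonneg_D; exact: le_trans ns.
have N0oo : (\int[leb]_(s in `[0%R, +oo[) (N (x s) `^ p)%:E < +oo)%E.
  apply: le_lt_trans NDi; apply: ge0_subset_integral.
  - exact: m0.
  - exact: mD.
  - exact: mf mD _.
  - by move=> s _; exact: f0.
  - exact: sub0.
have small (e : R) : 0 < e -> \forall t \near +oo,
    (Lp_norm N p (lco (- largest_delay tau t) 0) (history x t) <= e%:E)%E.
  move=> e0.
  (* The threshold is e^p since the norm is a p-th root. For t > t1, [sigma1] is at least n on [t,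
     +oo[, so |t - h(t), t) lies in [n, +oo[. *)
  have [n Nn] := integral_tail_lt (mf _ (m0 0) (sub0 _ (lexx 0))) f0 N0oo
    (powR_gt0 p e0).
  have [t1 [_ t1n]] := (cvgryPge _).1 sigma1_oo n%:R.
  (* The maximum with 0 ensures t >= 0, as [Lp_norm_history] requires. *)
  exists (Num.max t1 0); split; first exact: num_real.
  move=> t; rewrite gt_max => /andP[t1t t0].
  rewrite Lp_norm_history ?(ltW t0)//.
  have -> : (e%:E = ((e `^ p)%:E `^ p^-1))%E.
    by rewrite poweR_EFin -powRrM mulfV ?gt_eqF// powRr1 ?ltW.
  have i0 (E : set (lebesgueType R)) :
      (0 <= \int[leb]_(s in E) (N (x s) `^ p)%:E)%E.
    exact: integral_ge0.
  apply: gt0_ler_poweR; rewrite ?in_itv/= ?invr_ge0 ?(ltW p_gt0)// ?i0 ?leey//.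
    by rewrite lee_fin powR_ge0.
  apply: le_trans (ltW Nn); apply: ge0_subset_integral.
  - exact: measurable_lco.
  - exact: m0.
  - by apply: mf; [exact: m0|exact: sub0].
  - by move=> s _; exact: f0.
  - move=> s; rewrite /lco/= in_itv/= andbT => /andP[+ _].
    rewrite -lee_fin; apply: le_trans; apply: le_ereal_inf_tmp => _ [u /= + <-].
    rewrite in_itv/= andbT lee_fin => tu; apply: t1n.
    exact: lt_le_trans tu.
have L0 t : (0 <= Lp_norm N p (lco (- largest_delay tau t) 0) (history x t))%E.
  exact: Lnorm_ge0.
apply/fine_cvgP; split.
  apply: filterS (small _ ltr01) => t t1.
  by rewrite ge0_fin_numE// (le_lt_trans t1)// ltry.
apply/cvgrPdist_le => e e0; apply: filterS (small _ e0) => t te /=.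
rewrite sub0r normrN ger0_norm ?fine_ge0//.
by rewrite -lee_fin fineK// ge0_fin_numE// (le_lt_trans te)// ltry.
Qed.
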